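(* Let $H$ be a uniformly random undirected hypergraph with degree sequence $((d_v)_{v\in V},(\delta_e)_{e\in E})$, where $n=|V|$, and suppose $\delta_e \leq \frac{1}{2} n \mathbb{E}[d_U]$ for all $e \in E$. Then the expected number $\mathbb{E}[M_n]$ of multi-hyperedge pairs is $$\mathbb{E}[M_n]= \frac{1}{2} \sum_{e \in E} \sum_{\substack{e' \in E\setminus\{e\}:\\ \delta_{e'}=\delta_e}}\frac{(n\mathbb{E}[d_U]-2\delta_e)!}{(n \mathbb{E}[d_U])!}\sum_{\substack{\mathbf{a} \in \mathbb{N}^{\delta_e}:\\ \sum_{i=1}^{\delta_e} ia_i = \delta_e}} \frac{\delta_e!^2}{\prod_{k=1}^{\delta_e} k!^{2a_k} }\sum_{\alpha \in R(\mathbf{a})} (-1)^{\sum_{\mathbf{x} \in \mathbb{N}^{\delta_e}} (\sum_{i=1}^{\delta_e} x_i - 1)\alpha(\mathbf{x})}$$ $$\times \prod_{\mathbf{y} \in \mathbb{N}^{\delta_e}} \left( \frac{1}{\alpha(\mathbf{y})!} \left(\frac{n\,\mathbb{E}\left[\prod_{i=1}^{\delta_e} \left(\mathbf{1}_{\{d_U \geq 2i\}}\frac{d_U!}{(d_U-2i)!}\right)^{y_i} \right]\left(\sum_{i=1}^{\delta_e} y_i-1 \right)!}{\prod_{i=1}^{\delta_e} y_i!} \right)^{\alpha(\mathbf{y})} \right).$$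
   Context: $\mathbb{N}$ contains $0$, and $0^0=1$. Let $V$ be a finite vertex set with $n=|V|$ and $E$ a finite set of (labelled) hyperedges. An undirected degree sequence consists of vertex degrees $d_v\in\mathbb{N}$ ($v\in V$) and hyperedge degrees $\delta_e\in\mathbb{N}$ ($e\in E$) with $\sum_{v}d_v=\sum_e\delta_e$. A uniformly random (stub-labeled) undirected hypergraph with this degree sequence is obtained as follows: each vertex $v$ has $d_v$ distinguishable stubs, and all stubs are distributed over the hyperedges so that each hyperedge $e$ receives exactly $\delta_e$ stubs (as a set: the slots within a hyperedge are interchangeable); every such assignment is equally likely. Each hyperedge $e$ is then a multiset of vertices in which $v$ has multiplicity $m_v(e)$ equal to the number of stubs of $v$ assigned to $e$. Two distinct hyperedges $e_1,e_2\in E$ form a multi-hyperedge pair if they are equal as multisets of vertices; $M_n$ is the number of unordered multi-hyperedge pairs. $U$ is a uniformly chosen vertex of $V$, and $d_U$ its degree (so $n\mathbb{E}[d_U]=\sum_v d_v$). For $\delta\in\mathbb{N}$ and $\mathbf{a}\in\mathbb{N}^{\delta}$, $R(\mathbf{a})$ is the set of functions $\alpha:\mathbb{N}^{\delta}\to\mathbb{N}$ with $\alpha(\mathbf{0})=0$ and $\sum_{\mathbf{x}\in\mathbb{N}^{\delta}}x_i\,\alpha(\mathbf{x})=a_i$ for all $i\in\{1,\dots,\delta\}$. Factors of the product with $\alpha(\mathbf{y})=0$ (in particular $\mathbf{y}=\mathbf{0}$) are equal to $1$, and the indicator times the quotient is $0$ when the indicator is $0$. *)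

(* Defs.v *)
From mathcomp Require Import all_boot all_order all_algebra.
From mathcomp Require Import boolp classical_sets functions cardinality fsbigop.

Set Implicit Arguments.
Unset Strict Implicit.
Unset Printing Implicit Defensive.

Import Order.TTheory GRing.Theory Num.Theory.
Local Open Scope ring_scope.

Section Uniform.
Variables (R : realFieldType) (T : finType).

(* Expectation of X under the uniform distribution on {x | A x}. *)
Definition unif_mean (A : pred T) (X : T -> R) : R :=
  (\sum_(x | A x) X x) / #|A|%:R.

End Uniform.

Section RandomHypergraph.
Variables (V E : finType) (d : V -> nat) (delta : E -> nat).

Definition stub : finType := {v : V & 'I_(d v)}.

(* The hyperedge e is the set of stubs sent to e: slots carry no order. *)
Definition stub_assignment : pred {ffun stub -> E} :=
  fun s => [forall e, #|[pred x | s x == e]| == delta e].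

Definition multiplicity (s : {ffun stub -> E}) (v : V) (e : E) : nat :=
  #|[pred x : stub | (tag x == v) && (s x == e)]|.

Definition same_hyperedge (s : {ffun stub -> E}) (e1 e2 : E) : bool :=
  [forall v, multiplicity s v e1 == multiplicity s v e2].

(* An unordered pair of distinct hyperedges is a two-element set p. *)
Definition multi_hyperedge_pairs (s : {ffun stub -> E}) : nat :=
  #|[pred p : {set E} |
      (#|p| == 2) && [forall e1 in p, forall e2 in p, same_hyperedge s e1 e2]]|.

Definition expected_multi_hyperedge_pairs (R : realFieldType) : R :=
  unif_mean stub_assignment (fun s => (multi_hyperedge_pairs s)%:R).

End RandomHypergraph.

(* E[g(d_U)] for a uniformly chosen vertex U. *)
Definition degree_mean (R : realFieldType) (V : finType) (d : V -> nat)
    (g : nat -> R) : R :=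
  unif_mean (xpredT : pred V) (fun v => g (d v)).

(* n E[d_U] as a natural number, so that factorials of it make sense. *)
Definition total_degree (V : finType) (d : V -> nat) : nat := (\sum_v d v)%N.

Lemma total_degreeE (R : realFieldType) (V : finType) (d : V -> nat) :
  (total_degree d)%:R = #|V|%:R * degree_mean d (fun k => k%:R) :> R.
Proof.
rewrite /degree_mean /unif_mean mulrCA -natr_sum.
have [/eqP|V0] := eqVneq (#|V|%:R : R) 0; last by rewrite divff ?mulr1.
rewrite pnatr_eq0 => /eqP V0; rewrite V0 mul0r mulr0 /total_degree big1 //.
by move=> v _; move/card0_eq: V0 => /(_ v).
Qed.

Notation natvec k := {ffun 'I_k -> nat}.

(* The coordinates 1, ..., k of a vector are indexed by 'I_k, with i : 'I_k
   standing for i.+1. *)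
Definition weight_vectors (k : nat) : set (natvec k) :=
  [set a | (\sum_(i < k) i.+1 * a i)%N = k]%classic.
Arguments weight_vectors k : clear implicits.

(* The falling factorials of d_U occurring here have 2 i factors since a vertex
   of multiplicity i in two equal hyperedges uses up 2 i of its stubs.
   The truncated subtraction matters only at y = 0, where the exponent alpha y
   of this weight is 0. *)
Definition block_weight (R : realFieldType) (V : finType) (d : V -> nat)
    (k : nat) (y : natvec k) : R :=
  #|V|%:R *
  degree_mean d (fun dU => \prod_(i < k)
    ((2 * i.+1 <= dU)%N%:R * (dU`!%:R / (dU - 2 * i.+1)`!%:R)) ^+ y i) *
  ((\sum_(i < k) y i) - 1)`!%:R / (\prod_(i < k) (y i)`!)%N%:R.

(* A sum over \in evaluates to 0 on infinite support, so convergence of the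
   sums over N^k has to be required; as alpha 0 = 0 and the terms are natural
   numbers, it amounts to the finiteness of the support of alpha. *)
Definition R_set (k : nat) (a : natvec k) : set (natvec k -> nat) :=
  [set alpha | [/\ alpha [ffun=> 0%N] = 0%N,
     finite_set [set x | alpha x <> 0%N] &
     forall i, \big[addn/0%N]_(x \in [set: natvec k]) (x i * alpha x)%N = a i]]%classic.

(* The two lemmas below ensure that the sums over weight_vectors and R_set are
   genuine sums. *)
Lemma finite_weight_vectors k : finite_set (weight_vectors k).
Proof.
pose g (h : {ffun 'I_k -> 'I_k.+1}) : natvec k := [ffun i => h i : nat].
apply: (@sub_finite_set _ _ (g @` setT)%classic); last first.
  exact/finite_image/finite_finset.
move=> a /= wa; exists [ffun i => inord (a i)] => //.
apply/ffunP => i; rewrite !ffunE inordK // ltnS -[leqRHS]wa (bigD1 i) //=.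
by rewrite (leq_trans _ (leq_addr _ _)) // leq_pmull.
Qed.

Lemma finite_R_set k (a : natvec k) : finite_set (R_set a).
Proof.
pose B := (\sum_i a i)%N.
pose g (h : {ffun {ffun 'I_k -> 'I_B.+1} -> 'I_B.+1}) (x : natvec k) : nat :=
  if [forall i, x i <= B]%N then h [ffun i => inord (x i)] : nat else 0%N.
apply: (@sub_finite_set _ _ (g @` setT)%classic); last first.
  exact/finite_image/finite_finset.
have aB i : (a i <= B)%N by rewrite /B (bigD1 i) //= leq_addr.
move=> alpha /= [alpha0 fin Ra].
have le_a (x : natvec k) i : (x i * alpha x <= a i)%N.
  have [->//|nz] := eqVneq (x i * alpha x)%N 0%N.
  rewrite -(Ra i) (big_rem x) ?leq_addr //= in_finite_support.
    by rewrite inE; split=> //; apply/eqP.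
  apply: (sub_finite_set _ fin) => y [_ /= ny] /= ay0.
  by apply: ny; rewrite ay0 muln0.
exists [ffun y : {ffun 'I_k -> 'I_B.+1} => inord (alpha [ffun i => y i : nat])] => //.
apply/funext => x; rewrite /g; case: ifPn => [/forallP xB|xB].
  rewrite ffunE; have -> : [ffun i => [ffun j : 'I_k => inord (x j) : 'I_B.+1] i : nat] = x.
    by apply/ffunP => i; rewrite !ffunE inordK // ltnS.
  rewrite inordK // ltnS; have [->|x0] := eqVneq x [ffun=> 0%N].
    by rewrite alpha0.
  have [i xi|xz] := pickP (fun i => x i != 0%N).
    by rewrite (leq_trans _ (aB i)) // (leq_trans _ (le_a x i)) // leq_pmull // lt0n.
  case/eqP: x0; apply/ffunP => i; rewrite ffunE; apply/eqP.
  by rewrite -[_ == _]negbK xz.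
move: xB; rewrite negb_forall => /existsP[i]; rewrite -ltnNge => Bi.
apply/esym/eqP; rewrite -leqn0 leqNgt; apply/negP => alx.
have := leq_trans (leq_pmulr (x i) alx) (leq_trans (le_a x i) (aB i)).
by rewrite leqNgt Bi.
Qed.

(* Main.v *)
Require Import Defs.
From mathcomp Require Import all_boot all_order all_algebra.
From mathcomp Require Import boolp classical_sets functions cardinality fsbigop.
From mathcomp Require Import zify ring.
Import Order.TTheory GRing.Theory Num.Theory.
Local Open Scope ring_scope.

Set Implicit Arguments.
Unset Strict Implicit.
Unset Printing Implicit Defensive.

(** By linearity of expectation, one has to find, for two given hyperedges of the
    same degree [k], the probability that they are equal as multisets.  Let [T] be
    the number of stubs.  For a given vector [m] of multiplicities with sum [k],
    the assignments giving both hyperedges the multiplicities [m] are counted by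
    multinomial coefficients ([card_ffun_fibers], used for all the counts below),
    and their proportion is
      [(T - 2k)! / T! * k!^2 * \prod_v q v (m v)],
    where [q v j = d_v! / ((d_v - 2j)! j!^2)] if [2j <= d_v] and [q v j = 0]
    otherwise ([equal_pair_probability]).  So the probability is governed by
      [S = \sum_(m : \sum_v m v = k) \prod_v q v (m v)],
    the coefficient of [X^k] in [\prod_v (1 + u_v)], with
    [u_v = \sum_(i >= 1) q v i X^i].

    It remains to recognise [S] in the double sum over [a] and [alpha]
    ([formula_vertex_sum]).  Expand
      [\sum_v log (1 + u_v) = \sum_v \sum_(s >= 1) (-1)^(s-1) u_v^s / s]
    by the multinomial theorem: the sum runs over the vectors [y <> 0] with
    coefficients
      [W_y = (-1)^(|y|-1) (|y|-1)! / \prod_i y_i! * \sum_v \prod_i (q v i)^(y_i)],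
    on the monomials of degree [wt y = \sum_i i y_i].  Exponentiating term by term,
      [\prod_v (1 + u_v) = \prod_y exp (W_y X^(wt y))
         = \sum_alpha \prod_y W_y^(alpha y) / (alpha y)! X^(\sum_y wt y * alpha y)],
    and grouping the [alpha] of total weight [k] by [a_i = \sum_y y_i alpha y] gives
    the formula, the powers of the [1 / i!^2] contained in [q] being collected in
    [\prod_i i!^(-2 a_i)].

    The identity between the two products is only needed in degree at most [k],
    so it is proved for polynomials, with truncated logarithms and exponentials:
    both sides have constant term 1 and satisfy [F' = L' F] modulo [X^k] with the
    same [L], and this determines the coefficients ([exp_log_coef]). *)

(** * Functions with prescribed fibre sizes *)

Section FiberCounting.
Local Open Scope nat_scope.

(** The multinomial count, refined by a labelling [g] of the domain.  The value
    at the first point is [b], which leaves the counts [n] lowered by one at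
    [(g ord0, b)]; the factorials absorb the factor [n (g ord0, b)], and these
    factors sum to the size of the [g]-fibre of the first point. *)
Lemma card_ord_ffun_fibers (V B : finType) N (g : 'I_N -> V) (n : V * B -> nat) :
  (forall v, \sum_b n (v, b) = \sum_(a < N) (g a == v)) ->
  (\sum_(f : {ffun 'I_N -> B})
      [forall p, \sum_(a < N) ((g a, f a) == p) == n p]) * \prod_p (n p)`! =
  \prod_v (\sum_(a < N) (g a == v))`!.
Proof.
elim: N g n => [|N IH] g n nE.
  have n0 p : n p = 0.
    case: p => v b; have := nE v; rewrite big_ord0 (bigD1 b) //=.
    by move=> /eqP; rewrite addn_eq0 => /andP[/eqP].
  rewrite (_ : \sum_f _ = 1); last first.
    rewrite (eq_bigr (fun=> 1)) => [|f _].
      by rewrite sum1_card card_ffun card_ord expn0.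
    rewrite (_ : [forall p, _] = true) //.
    by apply/forallP => p; rewrite big_ord0 n0.
  rewrite mul1n.
  rewrite !big1 // => [v|p] _; first by rewrite big_ord0.
  by rewrite n0.
pose v0 := g ord0; pose g' (a : 'I_N) := g (lift ord0 a).
pose cons (bf : B * {ffun 'I_N -> B}) : {ffun 'I_N.+1 -> B} :=
  [ffun i => if unlift ord0 i is Some j then bf.2 j else bf.1].
have cons_bij : bijective cons.
  exists (fun f : {ffun 'I_N.+1 -> B} =>
      (f ord0, [ffun j : 'I_N => f (lift ord0 j)])) => [[b f]|f].
    rewrite /cons !ffunE unlift_none; congr pair.
    by apply/ffunP => j; rewrite !ffunE liftK.
  apply/ffunP => i; rewrite !ffunE; case: unliftP => [j ->|->] //=.
  by rewrite ffunE.
rewrite (reindex cons) /=; last exact: onW_bij.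
rewrite -(pair_bigA _ (fun b f => nat_of_bool
  [forall p, \sum_(a < N.+1) ((g a, cons (b, f) a) == p) == n p])) /=.
rewrite big_distrl /=.
have cE v : \sum_(a < N.+1) (g a == v) = (v0 == v) + \sum_(a < N) (g' a == v).
  by rewrite big_ord_recl.
transitivity (\sum_b n (v0, b) * \prod_v (\sum_(a < N) (g' a == v))`!); last first.
  rewrite -big_distrl /= nE cE eqxx (bigD1 v0) //= mulnA.
  rewrite [RHS](bigD1 v0) //= !cE eqxx /= factS; congr (_ * _).
  by apply: eq_bigr => v nv; rewrite cE eq_sym (negbTE nv).
apply: eq_bigr => b _.
under eq_bigr => f _.
  under eq_forallb => p.
    rewrite big_ord_recl /cons ffunE unlift_none /=.
    under eq_bigr do rewrite ffunE liftK /=.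
  over.
over.
(* The value b is impossible at the first point when n (v0, b) = 0. *)
have [nb0|nb_gt0] := posnP (n (v0, b)).
  rewrite nb0 mul0n big1 ?mul0n // => f _; apply/eqP; rewrite eqb0.
  by apply/negP => /forallP /(_ (v0, b)); rewrite nb0 eqxx.
pose n' p := n p - ((v0, b) == p).
have nn' p : n p = ((v0, b) == p) + n' p.
  by rewrite /n' subnKC //; case: eqP => // <-.
rewrite -(IH g' n'); last first.
  move=> v; have := nE v; rewrite cE (eq_bigr _ (fun b _ => nn' (v, b))) big_split /=.
  rewrite (_ : \sum_i ((v0, b) == (v, i)) = (v0 == v)); first by move/addnI.
  have [->|nv] := eqVneq v0 v.
    rewrite (bigD1 b) //= eqxx big1 // => i nib.
    by rewrite xpair_eqE eqxx /= eq_sym (negbTE nib).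
  by rewrite big1 // => i _; rewrite xpair_eqE (negbTE nv).
rewrite mulnCA; congr (_ * _).
  apply: eq_bigr => f _; congr nat_of_bool; apply: eq_forallb => p.
  by rewrite nn' eqn_add2l.
rewrite (bigD1 (v0, b)) //= [in RHS](bigD1 (v0, b)) //= mulnA.
congr (_ * _); first by rewrite nn' eqxx -factS.
by apply: eq_bigr => p np; rewrite nn' eq_sym (negbTE np).
Qed.

Lemma card_sum_pred (T : finType) (P : pred T) : #|P| = \sum_x P x.
Proof.
by rewrite -sum1_card big_mkcond; apply: eq_bigr => x _; rewrite unfold_in; case: (P x).
Qed.

(** Stated as a product equation rather than as a quotient of factorials, so
    that it holds in the natural numbers without any divisibility argument. *)
Lemma card_ffun_fibers (A B V : finType) (g : A -> V) (n : V -> B -> nat) :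
  (forall v, \sum_b n v b = #|[pred a | g a == v]|) ->
  #|[pred f : {ffun A -> B} |
      [forall v, forall b, #|[pred a | (g a == v) && (f a == b)]| == n v b]]|
    * \prod_v \prod_b (n v b)`! = \prod_v (#|[pred a | g a == v]|)`!.
Proof.
move=> nE; pose u := @enum_val A predT.
have uB : bijective u := enum_val_bij A.
have cardE (P : pred A) : #|P| = \sum_(a < #|A|) P (u a).
  by rewrite card_sum_pred (reindex u) //; exact: onW_bij.
have := @card_ord_ffun_fibers V B #|A| (g \o u) (fun p => n p.1 p.2).
rewrite (eq_bigr (fun v => (#|[pred a | g a == v]|)`!)) => [<-|v _];
  last by rewrite (cardE [pred a | g a == v]).
- rewrite pair_bigA; congr (_ * _).
  pose h (f : {ffun 'I_#|A| -> B}) : {ffun A -> B} := [ffun a => f (enum_rank a)].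
  have hB : bijective h.
    exists (fun f : {ffun A -> B} => [ffun i : 'I_#|A| => f (u i)]) => f;
      apply/ffunP => i; rewrite !ffunE.
      by rewrite enum_valK.
    by rewrite /u enum_rankK.
  rewrite [X in X = _]card_sum_pred (reindex h) /=; last exact: onW_bij.
  apply: eq_bigr => f _; congr nat_of_bool.
  apply/forallP/forallP => [H [v b]|H v]; last apply/forallP => b.
    have /forallP/(_ b)/eqP <- := H v.
    rewrite (cardE [pred a | (g a == v) && (h f a == b)]); apply/eqP/eq_bigr => a _.
    by rewrite /h /= ffunE enum_valK xpair_eqE.
  rewrite -(eqP (H (v, b))) (cardE [pred a | (g a == v) && (h f a == b)]).
  apply/eqP/eq_bigr => a _.
    by rewrite /h /= ffunE enum_valK xpair_eqE.
- by move=> v; rewrite nE (cardE [pred a | g a == v]).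
Qed.

Lemma card_ffun_multinomial (A B : finType) (n : B -> nat) :
  \sum_b n b = #|A| ->
  #|[pred f : {ffun A -> B} | [forall b, #|[pred a | f a == b]| == n b]]|
    * \prod_b (n b)`! = (#|A|)`!.
Proof.
move=> nE; have bigu (F : unit -> nat) : \prod_v F v = F tt.
  by rewrite (bigD1 tt) //= big1 ?muln1 // => -[].
have cE v : #|[pred a : A | tt == v]| = #|A| by case: v; apply: eq_card.
have := @card_ffun_fibers A B unit (fun=> tt) (fun=> n).
rewrite !bigu cE => H; rewrite -H => [|v]; last by rewrite nE; symmetry; exact: cE.
congr (_ * _); apply: eq_card => f; rewrite !inE.
apply/idP/idP => [Hf|/forallP/(_ tt) //].
by apply/forallP => -[].
Qed.

End FiberCounting.

(** * Logarithmic derivatives modulo a power of the indeterminate *)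

Lemma natfact_neq0 (R : numDomainType) n : n`!%:R != 0 :> R.
Proof. by rewrite pnatr_eq0 -lt0n fact_gt0. Qed.

(** The bound [k] only serves to let the exponents range over a finite type. *)
Lemma multinomial_expansion (R : numFieldType) (T : comAlgType R) (I : finType) (c : I -> T)
    (s k : nat) : (s <= k)%N ->
  (\sum_i c i) ^+ s =
  \sum_(y : {ffun I -> 'I_k.+1} | (\sum_i y i)%N == s)
     (s`!%:R / (\prod_i (y i)`!)%N%:R) *: \prod_i c i ^+ y i.
Proof.
move=> le_sk; rewrite -[s in LHS]card_ord -prodr_const bigA_distr_bigA /=.
pose cnt (f : {ffun 'I_s -> I}) i := #|[pred j | f j == i]|.
have cnt_le f i : (cnt f i <= k)%N.
  by rewrite (leq_trans _ le_sk) // -[leqRHS](card_ord s) max_card.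
pose pr (f : {ffun 'I_s -> I}) : {ffun I -> 'I_k.+1} := [ffun i => inord (cnt f i)].
have prE f i : pr f i = cnt f i :> nat by rewrite ffunE inordK // ltnS.
have cnt_sum f : (\sum_i cnt f i)%N = s.
  transitivity (\sum_(j < s) 1)%N; last by rewrite sum1_card card_ord.
  rewrite [RHS](partition_big f xpredT) //=.
  by apply: eq_bigr => i _; rewrite /cnt -sum1_card.
rewrite (partition_big pr (fun y : {ffun I -> 'I_k.+1} => (\sum_i y i)%N == s)) /=; last first.
  by move=> f _; rewrite (eq_bigr (cnt f)) ?cnt_sum // => i _; rewrite prE.
apply: eq_bigr => y /eqP ys.
rewrite (eq_bigr (fun=> \prod_i c i ^+ y i)) => [|f /eqP <-]; last first.
  rewrite (partition_big f xpredT) //=; apply: eq_bigr => i _.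
  rewrite (eq_bigr (fun=> c i)) => [|j /eqP -> //].
  by rewrite prodr_const prE.
rewrite sumr_const -scaler_nat; congr (_ *: _).
apply/eqP; rewrite eq_sym -(inj_eq (mulIf (_ : (\prod_i (y i)`!)%N%:R != 0))); last first.
  by rewrite pnatr_eq0 -lt0n prodn_gt0 // => i; rewrite fact_gt0.
rewrite divfK; last by rewrite pnatr_eq0 -lt0n prodn_gt0 // => i; rewrite fact_gt0.
rewrite -[s in s`!]card_ord -(@card_ffun_multinomial 'I_s I (fun i => y i)) ?card_ord //.
rewrite natrM; apply/eqP; congr (_%:R * _); apply: eq_card => f.
rewrite [LHS]/(_ \in _) /= -[RHS]/(pr f == y).
apply/idP/idP => [/forallP H|/eqP <-].
  by apply/eqP/ffunP => i; apply: val_inj; rewrite /= prE; apply/eqP/H.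
by apply/forallP => i; rewrite prE.
Qed.

Lemma deriv_eqmX (R : fieldType) k (p q : {poly R}) :
  'X^(k.+1) %| p - q -> 'X^k %| p^`() - q^`().
Proof.
case/dvdpP => r; rewrite -derivB => ->; rewrite derivM derivXn.
apply: dvdp_add; first by apply: dvdp_mull; rewrite dvdp_exp2l.
by rewrite mulrnAr -mulrnAl dvdp_mull.
Qed.

Lemma eqmX_coef (R : fieldType) k (p q : {poly R}) :
  'X^k %| p - q -> forall n, (n < k)%N -> p`_n = q`_n.
Proof.
case/dvdpP => r E n nk; apply/eqP; rewrite -subr_eq0 -coefB E coefMXn.
by rewrite nk.
Qed.

(** The hypothesis says that the logarithmic derivative of [f i] is [l i] modulo
    ['X^k]; logarithmic derivatives of products add up.  Writing it without a
    division keeps everything inside polynomials. *)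
Lemma dlog_prod (R : fieldType) k (I : finType) (f l : I -> {poly R}) :
  (forall i, 'X^k %| (f i)^`() - l i * f i) ->
  'X^k %| (\prod_i f i)^`() - (\sum_i l i) * \prod_i f i.
Proof.
move=> fl; elim/big_rec2: _ => [|i p q _ IH].
  by rewrite derivC mul0r subr0 dvdp0.
rewrite derivM.
rewrite (_ : _ - _ = ((f i)^`() - l i * f i) * q + f i * (q^`() - p * q)); last by ring.
by apply: dvdp_add; [apply: dvdp_mulr | apply: dvdp_mull].
Qed.

(** Comparing coefficients in [p^`() = L * p] gives [n.+1 * p`_n.+1] in terms of
    the coefficients of [p] up to [n], so the equation and the constant term
    determine [p] up to degree [k]. *)
Lemma dlog_unique (R : numFieldType) k (L p q : {poly R}) :
  p`_0 = q`_0 -> 'X^k %| p^`() - L * p -> 'X^k %| q^`() - L * q ->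
  forall n, (n <= k)%N -> p`_n = q`_n.
Proof.
move=> pq0 Hp Hq; elim/ltn_ind => -[//|n] IH nk.
have := eqmX_coef Hp nk; have := eqmX_coef Hq nk; rewrite !coef_deriv !coefMr => Eq Ep.
apply: (@mulIf _ n.+1%:R); first by rewrite pnatr_eq0.
rewrite !mulr_natr Ep Eq; apply: eq_bigr => i _; rewrite IH ?(leq_trans _ nk) //.
exact: ltnW (ltn_ord i).
Qed.

(** The exponential series of [w *: 'X^m], cut after the power [k]. *)
Definition trunc_exp (R : numFieldType) (k : nat) (w : R) (m : nat) : {poly R} :=
  \sum_(j < k.+1) (w ^+ j / j`!%:R) *: 'X^(m * j).

Lemma dlog_trunc_exp (R : numFieldType) k (w : R) m :
  'X^k %| (trunc_exp k w m)^`() - (w *: 'X^m)^`() * trunc_exp k w m.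
Proof.
case: m => [|m].
  rewrite derivZ derivXn mulr0n scaler0 mul0r subr0 /trunc_exp raddf_sum big1 ?dvdp0 // => j _.
  by rewrite /= derivZ mul0n derivC scaler0.
(* The derivative shifts the series by one index, so the two sides differ only
   by the last term a k. *)
pose a j : {poly R} := (w *: 'X^(m.+1))^`() * ((w ^+ j / j`!%:R) *: 'X^(m.+1 * j)).
rewrite (_ : _ - _ = - a k); last first.
  rewrite /trunc_exp raddf_sum mulr_sumr big_ord_recl [X in _ - X]big_ord_recr /=.
  rewrite derivZ muln0 derivC scaler0 add0r opprD addrA -sumrB big1 ?sub0r //.
  move=> j _; apply/eqP; rewrite subr_eq0 !derivZ !derivXn /bump leq0n add1n.
  rewrite (_ : (m.+1 * j.+1).-1 = m + m.+1 * j)%N; last by lia.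
  rewrite -[_ *+ (m.+1 * j.+1)]scaler_nat -[_ *+ m.+1]scaler_nat !scalerA.
  rewrite -scalerAl -scalerAr scalerA -exprD; apply/eqP; congr (_ *: _).
  have jn0 : j.+1%:R != 0 :> R by rewrite pnatr_eq0.
  rewrite factS !natrM exprS; move: jn0 (natfact_neq0 R j).
  move: (j.+1%:R : R) (j`!%:R : R) => x y x0 y0; field.
  by rewrite y0 x0.
rewrite dvdpNr /a; apply: dvdp_mull; rewrite -mul_polyC; apply: dvdp_mull.
by rewrite dvdp_exp2l // leq_pmull.
Qed.

Lemma trunc_exp_coef0 (R : numFieldType) k (w : R) m :
  (m = 0%N -> w = 0) -> (trunc_exp k w m)`_0 = 1.
Proof.
move=> w0; rewrite /trunc_exp big_ord_recl expr0 fact0 muln0 divr1 scale1r expr0.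
rewrite coefD coef1 /= coef_sum big1 ?addr0 // => j _; rewrite coefZ coefXn.
case: m w0 => [->|m] //; first by rewrite expr0n mul0r mul0r.
by rewrite mulr0.
Qed.

(** The derivative of the truncated logarithm of [1 + u] is a geometric sum in
    [- u] times [u^`()]; multiplied by [1 + u] it telescopes. *)
Lemma dlog_trunc_log (R : numFieldType) k (u : {poly R}) : 'X %| u ->
  'X^k %| (1 + u)^`() -
     (\sum_(s < k) ((-1) ^+ s / s.+1%:R) *: u ^+ s.+1)^`() * (1 + u).
Proof.
move=> Xu; rewrite derivD derivC add0r raddf_sum /=.
have -> : \sum_(s < k) (((-1) ^+ s / s.+1%:R) *: u ^+ s.+1)^`() = u^`() * \sum_(s < k) (- u) ^+ s.
  rewrite mulr_sumr; apply: eq_bigr => s _.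
  rewrite derivZ deriv_exp /= -scaler_nat scalerA divfK ?pnatr_eq0 //.
  by rewrite -[- u]scaleN1r exprZn -scalerAr.
have E : (\sum_(s < k) (- u) ^+ s) * (1 + u) = 1 - (- u) ^+ k.
  by rewrite -[1 + u]opprK mulrN [_ * - _]mulrC opprD addrC -subrX1 opprB.
rewrite -mulrA E mulrBr mulr1 opprB addrC subrK; apply: dvdp_mull.
by apply: dvdp_exp2r; rewrite dvdpNr.
Qed.

(** * The exponential of a sum of logarithms *)

Section LogSeries.
Variables (R : numFieldType) (V : finType) (k : nat) (q : V -> nat -> R).
Local Notation Y := {ffun 'I_k -> 'I_k.+1}.

Definition mass (y : Y) : nat := \sum_(i < k) y i.

(** The degree of the monomial of exponent [y] once the variable of index [i] is
    replaced by ['X^(i.+1)]. *)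
Definition vweight (y : Y) : nat := \sum_(i < k) i.+1 * y i.

(** The coefficient of the monomial of exponent [y] in the sum over [v] of the
    logarithms of [1 + \sum_i q v i.+1 z_i], in commuting variables [z_i].  It is
    set to 0 at [y = 0] because a logarithm of a series with constant term 1 has
    no constant term. *)
Definition log_coef (y : Y) : R :=
  if mass y == 0%N then 0 else
  (-1) ^+ (mass y - 1) * ((mass y - 1)`!%:R / (\prod_(i < k) (y i)`!)%N%:R)
   * \sum_v \prod_(i < k) q v i.+1 ^+ y i.

Definition vertex_series v : {poly R} := \sum_(i < k) q v i.+1 *: 'X^(i.+1).

Lemma leq_mass_vweight (y : Y) : (mass y <= vweight y)%N.
Proof. by apply: leq_sum => i _; rewrite leq_pmull. Qed.

Lemma log_coefE (y : Y) s : mass y = s.+1 ->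
  log_coef y *: 'X^(vweight y) =
  \sum_v ((-1) ^+ s / s.+1%:R) *: (((s.+1)`!%:R / (\prod_(i < k) (y i)`!)%N%:R) *:
    \prod_(i < k) (q v i.+1 *: 'X^(i.+1)) ^+ y i).
Proof.
move=> ys; rewrite /log_coef ys subn1 /= mulr_sumr scaler_suml; apply: eq_bigr => v _.
rewrite (eq_bigr (fun i : 'I_k => (q v i.+1 ^+ y i) *: 'X^(i.+1 * y i))); last first.
  by move=> i _; rewrite exprZn exprM.
rewrite scaler_prod prodrXr !scalerA; congr (_ *: _).
by rewrite factS natrM -!mulrA; congr (_ * _); rewrite mulKf // pnatr_eq0.
Qed.

(** Powers [s.+1 <= k] are expanded by the multinomial theorem; the [y] with
    [k < mass y] only contribute monomials of degree more than [k]. *)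
Lemma sum_log_coef :
  'X^(k.+1) %| \sum_y log_coef y *: 'X^(vweight y) -
     \sum_v \sum_(s < k) ((-1) ^+ s / s.+1%:R) *: vertex_series v ^+ s.+1.
Proof.
have -> : \sum_v \sum_(s < k) ((-1) ^+ s / s.+1%:R) *: vertex_series v ^+ s.+1 =
    \sum_(y : Y) \sum_(s < k | mass y == s.+1) log_coef y *: 'X^(vweight y).
  rewrite exchange_big [RHS](exchange_big_dep xpredT) //=; apply: eq_bigr => s _.
  rewrite [RHS](eq_bigr _ (fun y ys => log_coefE (eqP ys))) [RHS]exchange_big /=.
  apply: eq_bigr => v _; rewrite -scaler_sumr; congr (_ *: _).
  by rewrite /vertex_series (@multinomial_expansion _ _ _ _ _ k).
rewrite -sumrB; elim/big_ind: _ => [|p1 p2|y _]; first exact: dvdp0.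
  exact: dvdp_add.
have [y0|y_gt0] := posnP (mass y).
  by rewrite /log_coef y0 scale0r big1 ?subr0 ?dvdp0 // => s _; rewrite scale0r.
have [le_yk|lt_ky] := leqP (mass y) k.
  have yk : ((mass y).-1 < k)%N by rewrite prednK.
  rewrite (big_pred1 (Ordinal yk)) ?subrr ?dvdp0 // => s.
  by rewrite /= -val_eqE /= -[in LHS](prednK y_gt0) eqSS eq_sym.
rewrite big_pred0 => [|s]; last by apply/eqP => ys; have := ltn_ord s; lia.
rewrite subr0 -mul_polyC dvdp_mull // dvdp_exp2l //.
exact: leq_trans lt_ky (leq_mass_vweight y).
Qed.

(** This is [\prod_v (1 + u_v) = exp (\sum_v log (1 + u_v))] in degree [k], the
    exponential being split over the monomials of the logarithm.  Both sides have
    constant term 1 and the same logarithmic derivative modulo ['X^k]. *)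
Lemma exp_log_coef :
  (\prod_v (1 + vertex_series v))`_k = (\prod_y trunc_exp k (log_coef y) (vweight y))`_k.
Proof.
pose L : {poly R} := (\sum_(y : Y) log_coef y *: 'X^(vweight y))^`().
have coef0_prod (I : finType) (f : I -> {poly R}) :
    (forall i, (f i)`_0 = 1) -> (\prod_i f i)`_0 = 1.
  move=> f1; elim/big_ind: _ => [|p1 p2 E1 E2|i _]; rewrite ?coef1 //.
  by rewrite coef0M E1 E2 mulr1.
apply: (@dlog_unique _ k L) => //.
- rewrite !coef0_prod // => [y|v].
    apply: trunc_exp_coef0 => /eqP y0; rewrite /log_coef.
    by rewrite -leqn0 (leq_trans (leq_mass_vweight y)) // leqn0.
  rewrite coefD coef1 coef_sum big1 ?addr0 // => i _.
  by rewrite coefZ coefXn mulr0.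
- pose l v : {poly R} := (\sum_(s < k) ((-1) ^+ s / s.+1%:R) *: vertex_series v ^+ s.+1)^`().
  rewrite (_ : _ - _ = ((\prod_v (1 + vertex_series v))^`()
       - (\sum_v l v) * \prod_v (1 + vertex_series v))
     - (L - \sum_v l v) * \prod_v (1 + vertex_series v)); last by ring.
  apply: dvdp_sub.
    apply: dlog_prod => v; apply: dlog_trunc_log.
    rewrite /vertex_series; elim/big_ind: _ => [|p1 p2|i _]; [exact: dvdp0|exact: dvdp_add|].
    by rewrite -mul_polyC dvdp_mull // exprS dvdp_mulr.
  apply: dvdp_mulr; rewrite /L /l -raddf_sum; apply: deriv_eqmX; exact: sum_log_coef.
- rewrite /L raddf_sum; apply: dlog_prod => y; exact: dlog_trunc_exp.
Qed.

Lemma coef_prod_vertex_series : (forall v, q v 0%N = 1) ->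
  (\prod_v (1 + vertex_series v))`_k =
  \sum_(m : {ffun V -> 'I_k.+1} | (\sum_v m v)%N == k) \prod_v q v (m v).
Proof.
move=> q0; rewrite (eq_bigr (fun v => \sum_(j < k.+1) q v j *: 'X^j)) => [|v _]; last first.
  by rewrite big_ord_recl q0 expr0 scale1r.
rewrite bigA_distr_bigA coef_sum [RHS]big_mkcond; apply: eq_bigr => m _ /=.
rewrite scaler_prod prodrXr coefZ coefXn eq_sym.
by case: eqP; rewrite ?mulr1 ?mulr0.
Qed.

Lemma coef_prod_trunc_exp :
  (\prod_y trunc_exp k (log_coef y) (vweight y))`_k =
  \sum_(h : {ffun Y -> 'I_k.+1} | (\sum_y vweight y * h y)%N == k)
     \prod_y (log_coef y ^+ h y / (h y)`!%:R).
Proof.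
rewrite /trunc_exp bigA_distr_bigA coef_sum [RHS]big_mkcond; apply: eq_bigr => h _ /=.
rewrite scaler_prod prodrXr coefZ coefXn eq_sym.
by case: eqP; rewrite ?mulr1 ?mulr0.
Qed.

End LogSeries.

(** * Sums over vectors and functions as finite sums *)

Lemma fsbig_fin_image (R : Type) (idx : R) (op : Monoid.com_law idx)
    (J : finType) (I : choiceType) (h : J -> I) (A : set I) (P : pred J) (F : I -> R) :
  injective h -> A = (h @` [set j | P j])%classic ->
  \big[op/idx]_(i \in A) F i = \big[op/idx]_(j | P j) F (h j).
Proof.
move=> hI ->; rewrite fsbig_image; last by move=> x y _ _; apply: hI.
rewrite (bigfs op (r := index_enum J)) ?index_enum_uniq // => i _.
by rewrite mem_index_enum.
Qed.

(** In all the sums over vectors and over functions below, only vectors with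
    entries at most [k] and functions with values at most [k] matter, since the
    total weight is [k].  The maps [natvec_of] and [extend] embed the finite types
    of bounded vectors and of bounded functions on them. *)
Section Box.
Variable k : nat.
Local Notation Y := {ffun 'I_k -> 'I_k.+1}.
Definition natvec_of (y : Y) : natvec k := [ffun i => y i : nat].
Definition extend (h : {ffun Y -> 'I_k.+1}) (x : natvec k) : nat :=
  if [forall i, x i <= k]%N then h [ffun i => inord (x i)] : nat else 0%N.

Lemma natvec_of_inj : injective natvec_of.
Proof.
move=> x y /ffunP xy; apply/ffunP => i; apply: val_inj.
by have := xy i; rewrite !ffunE.
Qed.

Lemma natvec_of_onto (x : natvec k) : (forall i, (x i <= k)%N) ->
  natvec_of [ffun i => inord (x i)] = x.
Proof. by move=> xk; apply/ffunP => i; rewrite !ffunE inordK // ltnS. Qed.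

Lemma extendE h y : extend h (natvec_of y) = h y.
Proof.
rewrite /extend ifT; last by apply/forallP => i; rewrite ffunE -ltnS.
by congr (h _ : nat); apply/ffunP => i; rewrite !ffunE inord_val.
Qed.

Lemma extend_inj : injective extend.
Proof.
move=> h1 h2 eh; apply/ffunP => y; apply: val_inj => /=.
by rewrite -!extendE eh.
Qed.

Lemma fsbig_box (R : Type) (idx : R) (op : Monoid.com_law idx) (F : natvec k -> R) :
  (forall x : natvec k, ~~ [forall i, x i <= k]%N -> F x = idx) ->
  \big[op/idx]_(x \in [set: natvec k]) F x = \big[op/idx]_y F (natvec_of y).
Proof.
move=> F0; rewrite -(@fsbig_fin_image _ _ _ _ _ _ (range natvec_of) xpredT); last first.
- by congr image; apply/seteqP; split.
- exact: natvec_of_inj.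
apply/esym/fsbig_widen => // x [_ xN] /=; apply: F0; apply/negP => /forallP xk.
by apply: xN; exists [ffun i => inord (x i)] => //; exact: natvec_of_onto.
Qed.

Lemma weight_vectors_image : weight_vectors k =
  (natvec_of @` [set b : Y | (\sum_(i < k) i.+1 * b i)%N == k])%classic.
Proof.
apply/seteqP; split => [a /= wa|_ [b /= /eqP wb <-]]; last first.
  by rewrite /weight_vectors /= -[RHS]wb; apply: eq_bigr => i _; rewrite ffunE.
have ak i : (a i <= k)%N.
  rewrite -[leqRHS]wa (bigD1 i) //=.
  by rewrite (leq_trans _ (leq_addr _ _)) // leq_pmull.
exists [ffun i => inord (a i)]; last exact: natvec_of_onto.
rewrite /= -[X in _ == X]wa; apply/eqP; apply: eq_bigr => i _.
by rewrite ffunE inordK // ltnS.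
Qed.

Definition profile (h : {ffun Y -> 'I_k.+1}) (i : 'I_k) : nat := (\sum_(y : Y) y i * h y)%N.

(** A function [alpha] in [R_set] satisfies [x i * alpha x <= k]: it therefore
    vanishes outside the box, and, as it vanishes at 0, it is at most [k]
    everywhere. *)
Lemma R_set_image (b : Y) : R_set (natvec_of b) =
  (extend @` [set h : {ffun Y -> 'I_k.+1} |
    (h [ffun=> ord0] == ord0) && [forall i, profile h i == b i]])%classic.
Proof.
have nv0 : natvec_of [ffun=> ord0] = [ffun=> 0%N] by apply/ffunP => i; rewrite !ffunE.
apply/seteqP; split => [alpha [alpha0 fin Ra]|_ [h /= /andP[/eqP h0 /forallP hb] <-]]; last first.
  split.
  - by rewrite -nv0 extendE h0.
  - apply: (@sub_finite_set _ _ (range natvec_of)); last exact/finite_image/finite_finset.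
    move=> x /=; rewrite /extend; case: ifP => // /forallP xk _.
    by exists [ffun i => inord (x i)] => //; exact: natvec_of_onto.
  - move=> i; rewrite fsbig_box => [|x xN]; last by rewrite /extend (negbTE xN) muln0.
    rewrite ffunE -(eqP (hb i)); apply: eq_bigr => y _.
    by rewrite extendE ffunE.
have le_a (x : natvec k) i : (x i * alpha x <= k)%N.
  have [->//|nz] := eqVneq (x i * alpha x)%N 0%N.
  have : (natvec_of b i <= k)%N by rewrite ffunE -ltnS.
  apply: leq_trans; rewrite -(Ra i) (big_rem x) ?leq_addr //= in_finite_support.
    by rewrite inE; split=> //; apply/eqP.
  apply: (sub_finite_set _ fin) => y [_ /= ny] /= ay0.
  by apply: ny; rewrite ay0 muln0.
have alpha_out (x : natvec k) : ~~ [forall i, x i <= k]%N -> alpha x = 0%N.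
  rewrite negb_forall => /existsP[i]; rewrite -ltnNge => ki.
  have := le_a x i; case: (alpha x) => // m; rewrite mulnS => H.
  by have := leq_ltn_trans (leq_trans (leq_addr _ _) H) ki; rewrite ltnn.
have alpha_le x : (alpha x <= k)%N.
  have [->|x0] := eqVneq x [ffun=> 0%N]; first by rewrite alpha0.
  have [i xi|xz] := pickP (fun i => x i != 0%N).
    by rewrite (leq_trans _ (le_a x i)) // leq_pmull // lt0n.
  case/eqP: x0; apply/ffunP => i; rewrite ffunE; apply/eqP.
  by rewrite -[_ == _]negbK xz.
have alphaE : extend [ffun y => inord (alpha (natvec_of y))] = alpha.
  apply/funext => x; rewrite /extend; case: ifPn => [/forallP xk|/alpha_out -> //].
  by rewrite ffunE natvec_of_onto // inordK // ltnS.
exists [ffun y => inord (alpha (natvec_of y))] => //=.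
apply/andP; split; first by rewrite ffunE nv0 alpha0 -val_eqE /= inordK.
apply/forallP => i; have := Ra i; rewrite fsbig_box => [|x /alpha_out ->]; last by rewrite muln0.
rewrite ffunE => <-; apply/eqP; apply: eq_bigr => y _.
by rewrite !ffunE inordK // ltnS.
Qed.

Lemma profile_weight (h : {ffun Y -> 'I_k.+1}) :
  (\sum_(y : Y) vweight y * h y = \sum_(i < k) i.+1 * profile h i)%N.
Proof.
rewrite /profile; under [RHS]eq_bigr do rewrite big_distrr /=.
rewrite [RHS]exchange_big /=; apply: eq_bigr => y _.
by rewrite big_distrl /=; apply: eq_bigr => i _; rewrite mulnA.
Qed.
End Box.

(** * The double sum as a sum over multiplicities *)

Section Formula.
Variables (R : realFieldType) (V : finType) (d : V -> nat) (k : nat).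
Local Notation Y := {ffun 'I_k -> 'I_k.+1}.

(** The number of ways to choose an ordered pair of disjoint sets of [j] stubs
    at [v].  The value at [j = 0] is 1, so vertices outside the hyperedge need no
    separate treatment. *)
Definition vertex_weight (v : V) (j : nat) : R :=
  (2 * j <= d v)%N%:R * ((d v)`!%:R / (d v - 2 * j)`!%:R) / j`!%:R ^+ 2.

Lemma vertex_weight0 v : vertex_weight v 0 = 1.
Proof.
by rewrite /vertex_weight muln0 leq0n subn0 divff ?natfact_neq0 // fact0 expr1n invr1 !mulr1.
Qed.

(** The factor [k!^(-2 a_k)] of the formula, with [a_k = \sum_y y_k alpha y], is
    distributed over the vectors [y]; there it turns the falling factorials of
    [block_weight] into the vertex weights. *)
Lemma log_coef_block (y : Y) : mass y != 0%N ->
  log_coef vertex_weight y =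
  (-1) ^+ (mass y - 1) * ((\prod_(i < k) (i.+1)`! ^ (2 * y i))%N%:R^-1 *
   block_weight R d (natvec_of y)).
Proof.
move=> y0; rewrite /log_coef (negbTE y0) -mulrA; congr (_ * _).
rewrite /block_weight /degree_mean /unif_mean.
have -> : (\sum_(i < k) natvec_of y i)%N = mass y by apply: eq_bigr => i _; rewrite ffunE.
have -> : (\prod_(i < k) (natvec_of y i)`! = \prod_(i < k) (y i)`!)%N.
  by apply: eq_bigr => i _; rewrite ffunE.
set S := \sum_v _; set S' := \sum_v _.
have -> : #|V|%:R * (S' / #|xpredT : pred V|%:R) = S'.
  have [V0|V0] := eqVneq #|V| 0%N.
    by rewrite V0 mul0r /S' big1 // => v _; move/card0_eq: V0 => /(_ v).
  by rewrite mulrC divfK // pnatr_eq0.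
have -> : S = (\prod_(i < k) (i.+1)`! ^ (2 * y i))%N%:R^-1 * S'.
  rewrite /S /S' mulr_sumr; apply: eq_bigr => v _.
  rewrite natr_prod -prodfV -big_split /=; apply: eq_bigr => i _.
  rewrite ffunE /vertex_weight exprMn natrX exprVn -exprM mulnC mulrC.
  by rewrite -exprVn.
ring.
Qed.

(** The double sum over [a] and [alpha] is a single sum over the functions [alpha]
    of total weight [k], which is the expansion of the product of exponentials in
    [exp_log_coef]; the expansion of the other side of that identity is the sum
    over [m]. *)
Lemma formula_vertex_sum :
     \sum_(a \in weight_vectors k)
       (k`!%:R ^+ 2 / (\prod_(i < k) i.+1`! ^ (2 * a i))%N%:R *
        \sum_(alpha \in R_set a)
          ((-1) ^+ (\big[addn/0%N]_(x \in [set: natvec k])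
                      (((\sum_(i < k) x i) - 1) * alpha x))%N *
           \big[*%R/1]_(y \in [set: natvec k])
             ((alpha y)`!%:R^-1 * block_weight R d y ^+ alpha y))) =
  k`!%:R ^+ 2 * \sum_(m : {ffun V -> 'I_k.+1} | (\sum_v m v)%N == k)
     \prod_v vertex_weight v (m v).
Proof.
rewrite -coef_prod_vertex_series; last exact: vertex_weight0.
rewrite exp_log_coef coef_prod_trunc_exp.
rewrite (fsbig_fin_image _ _ (@natvec_of_inj k) (weight_vectors_image k)).
rewrite (bigID (fun h : {ffun Y -> 'I_k.+1} => h [ffun=> ord0] == ord0)) /=.
(* log_coef vanishes at the zero vector, so only functions that are 0 there
   contribute. *)
rewrite [X in _ + X]big1 ?addr0 => [|h /andP[_ h0]]; last first.
  rewrite (bigD1 [ffun=> ord0]) //= /log_coef ifT; last first.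
    by rewrite /mass big1 // => i _; rewrite ffunE.
  by move: h0; rewrite -val_eqE expr0n /= => /negbTE ->; rewrite !mul0r.
have le_prof (h : {ffun Y -> 'I_k.+1}) i : (\sum_y vweight y * h y)%N == k -> (profile h i <= k)%N.
  rewrite profile_weight => /eqP hk; rewrite -[leqRHS]hk (bigD1 i) //=.
  by rewrite (leq_trans _ (leq_addr _ _)) // leq_pmull.
rewrite (partition_big (fun h => [ffun i => inord (profile h i)] : Y)
   (fun b : Y => (\sum_(i < k) i.+1 * b i)%N == k)) /=; last first.
  move=> h /andP[hk _]; rewrite -[X in _ == X](eqP hk) profile_weight.
  by apply/eqP; apply: eq_bigr => i _; rewrite ffunE inordK // ltnS le_prof.
rewrite mulr_sumr; apply: eq_bigr => b /eqP bk.
rewrite (fsbig_fin_image _ _ (@extend_inj k) (R_set_image b)) -mulrA; congr (_ * _).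
rewrite mulr_sumr; apply: eq_big => [h|h /andP[/eqP h0 /forallP hb]].
  apply/idP/idP => [/andP[h0 /forallP hb]|/andP[/andP[hk h0] /eqP <-]].
    rewrite h0 profile_weight (eq_bigr (fun i : 'I_k => i.+1 * b i)%N); last first.
      by move=> i _; rewrite (eqP (hb i)).
    rewrite bk eqxx /=; apply/eqP/ffunP => i; apply: val_inj.
    by rewrite ffunE (eqP (hb i)) /= inordK.
  by rewrite h0; apply/forallP => i; rewrite ffunE inordK // ltnS le_prof.
rewrite !fsbig_box; first last.
- by move=> x xN; rewrite /extend (negbTE xN) muln0.
- by move=> x xN; rewrite /extend (negbTE xN) fact0 invr1 expr0 mulr1.
rewrite -prodrXr -big_split /=.
have -> : (\prod_(i < k) i.+1`! ^ (2 * natvec_of b i))%N =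
   (\prod_(y : Y) (\prod_(i < k) i.+1`! ^ (2 * y i)) ^ h y)%N.
  under [RHS]eq_bigr => y _ do
    rewrite (big_morph (fun m => m ^ h y)%N (fun m n => expnMn m n _) (exp1n _)).
  rewrite exchange_big /=; apply: eq_bigr => i _.
  under [RHS]eq_bigr do rewrite -expnM.
  rewrite -expn_sum ffunE -(eqP (hb i)) /profile big_distrr.
  by congr (_ ^ _)%N; apply: eq_bigr => y _ /=; rewrite mulnA.
rewrite natr_prod -prodfV -big_split /=; apply: eq_bigr => y _.
rewrite !extendE natrX.
have [->|y0] := eqVneq (h y) ord0.
  by rewrite /= muln0 !expr0 fact0 !(invr1, mulr1).
rewrite log_coef_block; last first.
  apply: contra y0 => /eqP vy0; rewrite -h0; apply/eqP; congr (h _).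
  apply/ffunP => i; apply: val_inj; rewrite ffunE /=.
  move: vy0 => /eqP; rewrite /mass sum_nat_eq0 => /forallP /(_ i) /= /eqP //.
have -> : (\sum_(i < k) natvec_of y i)%N = mass y by apply: eq_bigr => i _; rewrite ffunE.
rewrite exprM; move: (block_weight _ _ _) (_ %:R : R) (_ ^+ (_ - 1)) => B P S.
rewrite !exprMn exprVn -!mulrA mulrCA; congr (_ * _); rewrite mulrCA.
by rewrite [in RHS]mulrA [in RHS]mulrC.
Qed.
End Formula.

(** * Assignments in which two hyperedges are equal *)

Section AssignmentCounting.
Local Open Scope nat_scope.

Lemma sum_card_fibers (T B : finType) (f : T -> B) (P : pred T) :
  \sum_b #|[pred x | P x && (f x == b)]| = #|P|.
Proof.
rewrite -[RHS]sum1_card (partition_big f xpredT) //=.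
by apply: eq_bigr => b _; rewrite -sum1_card.
Qed.

(** A two-element set arises from exactly two ordered pairs. *)
Lemma sum_ordered_pairs (E : finType) (r : rel E) :
  reflexive r -> symmetric r ->
  \sum_e \sum_(e' | e' != e) r e e' =
  2 * #|[pred p : {set E} | (#|p| == 2) && [forall e1 in p, forall e2 in p, r e1 e2]]|.
Proof.
move=> rr rs; set P := [pred p : {set E} | _].
pose D := [pred x : E * E | (x.2 != x.1) && r x.1 x.2].
transitivity (\sum_(x | D x) 1).
  rewrite (pair_big_dep xpredT (fun e e' => e' != e) (fun e e' => r e e' : nat)) /=.
  rewrite [RHS]big_mkcond [LHS]big_mkcond.
  by apply: eq_bigr => -[a b] _ /=; case: (b != a); case: (r a b).
rewrite (partition_big (fun x => [set x.1; x.2]) P) /= => [|[a b] /andP[/= nba rab]]; last first.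
  rewrite cards2 (eq_sym a) nba /=; apply/forallP => x; apply/implyP => xab.
  apply/forallP => y; apply/implyP; move: xab; rewrite !inE.
  by move=> /orP[] /eqP -> /orP[] /eqP -> //; rewrite ?rr // rs.
rewrite (eq_bigr (fun=> 2)) => [|A /andP[/cards2P[a [b [nab ->]]] /forallP rA]].
  by rewrite sum_nat_const mulnC.
have rab : r a b.
  have := rA a; rewrite !inE eqxx /= => /forallP/(_ b).
  by rewrite !inE eqxx orbT.
rewrite (eq_bigl (mem [set (a, b); (b, a)])) => [|[x y]].
  by rewrite sum1_card cards2 xpair_eqE (negbTE nab).
rewrite !inE /= !xpair_eqE; apply/idP/idP => [/andP[/andP[nyx rxy] /eqP xyE]|].
  have := set21 x y; have := set22 x y; rewrite xyE !inE.
  move=> /orP[] /eqP ey /orP[] /eqP ex; move: nyx; rewrite ey ex ?eqxx ?orbT //.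
case/orP => /andP[/eqP -> /eqP ->].
  by rewrite (eq_sym b) nab rab eqxx.
by rewrite nab rs rab finset.setUC eqxx.
Qed.

Lemma big_option_bool (T : Type) (idx : T) (op : Monoid.com_law idx) (F : option bool -> T) :
  \big[op/idx]_j F j = op (F None) (op (F (Some true)) (F (Some false))).
Proof.
rewrite (bigD1 None) //= (bigD1 (Some true)) //= (bigD1 (Some false)) //=.
by rewrite big1 ?Monoid.mulm1 // => -[[]|].
Qed.

Section Counting.
Variables (V E : finType) (d : V -> nat) (delta : E -> nat).
Hypothesis hsum : \sum_v d v = \sum_e delta e.
Local Notation stub := (stub d).

Lemma card_stub_fiber v : #|[pred x : stub | tag x == v]| = d v.
Proof.
rewrite -[RHS]card_ord.
rewrite -(@card_codom _ _ (fun i : 'I_(d v) => Tagged (fun v => 'I_(d v)) i : stub)); last first.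
  by move=> i j /eqP; rewrite eq_Tagged => /eqP.
apply: eq_card => -[w i]; rewrite !inE /=; apply/eqP/codomP => [wv|[j /(congr1 tag)]//].
by case: _ / wv; exists i.
Qed.

Lemma card_stub : #|stub| = total_degree d.
Proof.
rewrite -(sum_card_fibers (fun x : stub => tag x)); apply: eq_bigr => v _.
by rewrite -(card_stub_fiber v).
Qed.

Lemma card_stub_assignment :
  #|stub_assignment delta (d := d)| * \prod_e (delta e)`! = (total_degree d)`!.
Proof. by rewrite -card_stub -(@card_ffun_multinomial _ _ delta) ?card_stub. Qed.

Lemma sum_multiplicity (s : {ffun stub -> E}) e :
  \sum_v multiplicity s v e = #|[pred x | s x == e]|.
Proof.
rewrite -(sum_card_fibers (fun x : stub => tag x)); apply: eq_bigr => v _.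
by apply: eq_card => x; rewrite !inE andbC.
Qed.

(** The classes [Some true] and [Some false] stand for the two hyperedges, the
    class [None] for all the others together. *)
Definition class_count (a : nat) (D : nat) (j : option bool) : nat :=
  if j is Some _ then a else D - 2 * a.

Section Pair.
Variables (e e' : E) (k : nat).
Hypotheses (ne : e' != e) (ek : delta e = k) (ek' : delta e' = k).

(** An assignment is built in two stages: first decide which stubs go to [e],
    which to [e'] and which elsewhere, then distribute the stubs of the last
    class. *)
Definition pair_class (f : E) : option bool :=
  if f == e then Some true else if f == e' then Some false else None.

Lemma pair_class_true f : (pair_class f == Some true) = (f == e).
Proof. by rewrite /pair_class; case: (f == e) => //; case: (f == e'). Qed.

Lemma pair_class_false f : (pair_class f == Some false) = (f == e').
Proof.
rewrite /pair_class; case: (eqVneq f e) => [->|_]; last by case: (f == e').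
by rewrite (eq_sym e) (negbTE ne).
Qed.

Lemma sum_class_delta j :
  \sum_(f | pair_class f == j) delta f = class_count k (total_degree d) j.
Proof.
have E1 : \sum_(f | pair_class f == Some true) delta f = k.
  by rewrite (eq_bigl _ _ pair_class_true) big_pred1_eq.
have E2 : \sum_(f | pair_class f == Some false) delta f = k.
  by rewrite (eq_bigl _ _ pair_class_false) big_pred1_eq.
case: j => [[]|]; [exact: E1|exact: E2|rewrite /class_count /total_degree hsum].
by rewrite [in RHS](partition_big pair_class xpredT) //= big_option_bool /= E1 E2
  mul2n -addnn addnK.
Qed.

(** The count does not depend on the choice [c] made in the first stage.  It is
    the refined multinomial count with the stubs labelled by [c], where the only
    way to label hyperedge [f] is by its own class. *)
Lemma card_refinements (c : {ffun stub -> option bool}) :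
  (forall j, #|[pred x | c x == j]| = class_count k (total_degree d) j) ->
  #|[pred s : {ffun stub -> E} | stub_assignment delta s &&
      [forall x, pair_class (s x) == c x]]| * \prod_f (delta f)`! =
  k`! * k`! * (total_degree d - 2 * k)`!.
Proof.
move=> ck; pose n j f := if pair_class f == j then delta f else 0.
have nE j : \sum_f n j f = #|[pred x | c x == j]|.
  by rewrite ck -sum_class_delta [RHS]big_mkcond.
have -> : k`! * k`! * (total_degree d - 2 * k)`! = \prod_j (#|[pred x | c x == j]|)`!.
  by rewrite big_option_bool /= !ck /= mulnC.
rewrite -(card_ffun_fibers nE); congr (_ * _); last first.
  rewrite exchange_big /=; apply: eq_bigr => f _.
  rewrite (bigD1 (pair_class f)) //= /n eqxx big1 ?muln1 // => j nj.
  by rewrite eq_sym (negbTE nj).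
apply: eq_card => s; rewrite !unfold_in /=.
apply/andP/forallP => [[/forallP sa /forallP sc] j|H].
  apply/forallP => f; rewrite /n; case: (pair_class f =P j) => [<-|nj].
    rewrite -(eqP (sa f)); apply/eqP/eq_card => x; rewrite !inE.
    rewrite -(eqP (sc x)); case: (s x =P f) => [->|]; by rewrite ?eqxx ?andbF.
  apply/eqP/eq_card0 => x; rewrite !inE -(eqP (sc x)); apply/negP => /andP[/eqP cj /eqP ef].
  by rewrite -ef cj in nj.
have sc x : pair_class (s x) = c x.
  have /forallP/(_ (s x)) := H (c x); rewrite /n.
  case: (pair_class (s x) =P c x) => // _ /eqP/card0_eq/(_ x).
  by rewrite !inE !eqxx.
split; last by apply/forallP => x; rewrite sc.
apply/forallP => f; have /forallP/(_ f) := H (pair_class f); rewrite /n eqxx => /eqP <-.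
apply/eqP/eq_card => x; rewrite !inE -sc; case: (s x =P f) => [->|]; by rewrite ?eqxx ?andbF.
Qed.

(** The refined multinomial count with each stub labelled by its vertex. *)
Lemma card_class_maps (m : V -> nat) : (forall v, 2 * m v <= d v) ->
  #|[pred c : {ffun stub -> option bool} | [forall v, forall j,
      #|[pred x : stub | (tag x == v) && (c x == j)]| == class_count (m v) (d v) j]]|
    * \prod_v ((m v)`! * (m v)`! * (d v - 2 * m v)`!) = \prod_v (d v)`!.
Proof.
move=> md; rewrite -(eq_bigr _ (fun v _ => congr1 factorial (card_stub_fiber v))).
rewrite -(@card_ffun_fibers _ _ _ _ (fun v j => class_count (m v) (d v) j)).
  by congr (_ * _); apply: eq_bigr => v _; rewrite big_option_bool /= mulnC.
move=> v; rewrite card_stub_fiber big_option_bool /=; have := md v; lia.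
Qed.

Lemma card_equal_pair (m : V -> nat) : \sum_v m v = k -> (forall v, 2 * m v <= d v) ->
  #|[pred s : {ffun stub -> E} | stub_assignment delta s &&
      [forall v, (multiplicity s v e == m v) && (multiplicity s v e' == m v)]]|
   * (\prod_f (delta f)`! * \prod_v ((m v)`! * (m v)`! * (d v - 2 * m v)`!)) =
  k`! * k`! * (total_degree d - 2 * k)`! * \prod_v (d v)`!.
Proof.
move=> mk md; rewrite -(card_class_maps md) mulnA mulnA; congr (_ * _).
set C := [pred c | [forall v, forall j, _]].
rewrite -(sum_card_fibers (fun s : {ffun stub -> E} => [ffun x => pair_class (s x)])).
(* The multiplicities at e and e' force the counts of the class map of s at
   every vertex, hence that map to lie in C. *)
rewrite (bigID C) /= [X in _ + X]big1 ?addn0 => [|c /negP nC]; last first.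
  apply: eq_card0 => s; rewrite !inE; apply/negP => /andP[/andP[sa /forallP sm] /eqP cs].
  apply: nC; apply/forallP => v.
  have mt : #|[pred x : stub | (tag x == v) && (c x == Some true)]| = m v.
    have /andP[/eqP <- _] := sm v; apply: eq_card => x.
    by rewrite !inE -cs ffunE pair_class_true.
  have mf : #|[pred x : stub | (tag x == v) && (c x == Some false)]| = m v.
    have /andP[_ /eqP <-] := sm v; apply: eq_card => x.
    by rewrite !inE -cs ffunE pair_class_false.
  apply/forallP => -[[]|]; [exact/eqP|exact/eqP|].
  have dE : d v = #|[pred x : stub | (tag x == v) && (c x == None)]| + (m v + m v).
    rewrite -{1}mt -{1}mf -(card_stub_fiber v) -(sum_card_fibers c).
    by rewrite big_option_bool.
  by apply/eqP; rewrite /class_count [in RHS]dE mul2n -addnn addnK.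
rewrite big_distrl /= (eq_bigr (fun=> k`! * k`! * (total_degree d - 2 * k)`!)) => [|c cC].
  by rewrite sum_nat_const mulnC.
have /forallP cC' := cC.
have cv v j : #|[pred x : stub | (tag x == v) && (c x == j)]| = class_count (m v) (d v) j.
  by have /forallP/(_ j)/eqP := cC' v.
rewrite -(@card_refinements c) => [|j].
  congr (_ * _); apply: eq_card => s; rewrite !inE -andbA; congr (_ && _).
  apply/andP/forallP => [[_ /eqP <-] x|H]; first by rewrite ffunE.
  have cs : [ffun x => pair_class (s x)] = c by apply/ffunP => x; rewrite ffunE; apply/eqP.
  split; last exact/eqP.
  apply/forallP => v; apply/andP; split; apply/eqP.
    rewrite -[RHS]/(class_count (m v) (d v) (Some true)) -cv.
    by apply: eq_card => x; rewrite !inE -cs ffunE pair_class_true.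
  rewrite -[RHS]/(class_count (m v) (d v) (Some false)) -cv.
  by apply: eq_card => x; rewrite !inE -cs ffunE pair_class_false.
rewrite -(sum_card_fibers (fun x : stub => tag x)).
rewrite (eq_bigr (fun v => class_count (m v) (d v) j)) => [|v _]; last first.
  by rewrite -cv; apply: eq_card => x; rewrite !inE andbC.
case: j => [b|] //=; rewrite sumnB // -big_distrr mk //.
Qed.

End Pair.
End Counting.

End AssignmentCounting.

(** * The expected number of multi-hyperedge pairs *)

Section Probability.
Variables (R : realFieldType) (V E : finType) (d : V -> nat) (delta : E -> nat).
Hypothesis hsum : (\sum_v d v = \sum_e delta e)%N.
Local Notation A := (stub_assignment delta (d := d)).

Lemma card_assignment_neq0 : #|A|%:R != 0 :> R.
Proof.
have := card_stub_assignment hsum; rewrite pnatr_eq0 => Heq; apply/eqP => A0.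
by have := fact_gt0 (total_degree d); rewrite -Heq A0.
Qed.

Lemma multiplicity_pair_le (s : {ffun stub d -> E}) v e e' : e' != e ->
  (multiplicity s v e + multiplicity s v e' <= d v)%N.
Proof.
move=> ne; rewrite -[leqRHS]card_stub_fiber -(sum_card_fibers s) (bigD1 e) //=.
rewrite (bigD1 e') //= addnA; exact: leq_addr.
Qed.

(** Both counts carry the factor [\prod_f (delta f)!], which cancels in the
    quotient.  When [2 * m v > d v] for some [v], both sides vanish. *)
Lemma equal_pair_probability (e e' : E) (m : V -> nat) :
  e' != e -> delta e' = delta e -> (\sum_v m v)%N = delta e ->
  #|[pred s | A s && [forall v, (multiplicity s v e == m v) && (multiplicity s v e' == m v)]]|%:R
    / #|A|%:R =
  (total_degree d - 2 * delta e)`!%:R / (total_degree d)`!%:R *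
    ((delta e)`!%:R ^+ 2 * \prod_v vertex_weight R d v (m v)).
Proof.
move=> ne ee mk.
have [/forallP md|] := boolP [forall v, 2 * m v <= d v]%N; last first.
  rewrite negb_forall => /existsP[v vm]; rewrite -ltnNge in vm.
  rewrite [X in _ * (_ * X)](bigD1 v) //= /vertex_weight leqNgt vm !mul0r !mulr0.
  rewrite eq_card0 ?mul0r // => s; rewrite !inE; apply/negP => /andP[_ /forallP/(_ v)].
  case/andP => /eqP m1 /eqP m2; have := multiplicity_pair_le s v ne.
  by rewrite m1 m2 addnn -mul2n leqNgt vm.
have := card_equal_pair hsum ne erefl ee mk md; have := card_stub_assignment hsum.
set N := #|_|; set M := #|_| => HN HM.
have N0 : N%:R != 0 :> R := card_assignment_neq0.
have {HN} HN := congr1 (fun n => n%:R : R) HN.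
have {HM} HM := congr1 (fun n => n%:R : R) HM.
move: HN HM; rewrite !natrM.
rewrite (eq_bigr (fun v => (m v)`! * (m v)`! * (d v - 2 * m v)`!)%N) //.
have -> : \prod_v vertex_weight R d v (m v) =
   (\prod_v (d v)`!)%N%:R / (\prod_v ((m v)`! * (m v)`! * (d v - 2 * m v)`!))%N%:R.
  rewrite !natr_prod -prodf_div; apply: eq_bigr => v _.
  rewrite /vertex_weight md mul1r !natrM; field.
  by rewrite !natfact_neq0.
have P0 : (\prod_v ((m v)`! * (m v)`! * (d v - 2 * m v)`!))%N%:R != 0 :> R.
  by rewrite pnatr_eq0 -lt0n prodn_gt0 // => v; rewrite !muln_gt0 !fact_gt0.
have Q0 : (\prod_f (delta f)`!)%N%:R != 0 :> R.
  by rewrite pnatr_eq0 -lt0n prodn_gt0 // => v; rewrite fact_gt0.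
move=> HN HM; rewrite -HN.
have := congr1 (fun x => x / (N%:R * (\prod_f (delta f)`!)%N%:R *
   (\prod_v ((m v)`! * (m v)`! * (d v - 2 * m v)`!))%N%:R)) HM.
move: N0 P0 Q0; clear.
move: (N%:R : R) (M%:R : R) ((delta e)`!%:R : R)
  ((total_degree d - 2 * delta e)`!%:R : R) => a b c f.
move: (_%:R : R) (_%:R : R) (_%:R : R) => p q r a0 r0 q0 H.
transitivity (b * (q * r) / (a * q * r)); first by field; rewrite a0 q0 r0.
by rewrite H; field; rewrite a0 q0 r0.
Qed.

Lemma same_hyperedge_degree (s : {ffun stub d -> E}) e e' :
  A s -> same_hyperedge s e e' -> delta e' = delta e.
Proof.
move=> /forallP sA /forallP se.
rewrite -(eqP (sA e)) -(eqP (sA e')) -!sum_multiplicity.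
by apply: eq_bigr => v _; rewrite (eqP (se v)).
Qed.

Lemma same_hyperedge_probability (e e' : E) :
  e' != e -> delta e' = delta e ->
  (\sum_(s | A s) (same_hyperedge s e e')%:R) / #|A|%:R =
  (total_degree d - 2 * delta e)`!%:R / (total_degree d)`!%:R *
    ((delta e)`!%:R ^+ 2 *
     \sum_(m : {ffun V -> 'I_(delta e).+1} | (\sum_v m v)%N == delta e)
        \prod_v vertex_weight R d v (m v)).
Proof.
move=> ne ee; pose k := delta e.
pose pr (s : {ffun stub d -> E}) : {ffun V -> 'I_k.+1} := [ffun v => inord (multiplicity s v e)].
have sume s : A s -> (\sum_v multiplicity s v e)%N = k.
  by move=> /forallP/(_ e)/eqP; rewrite sum_multiplicity.
have prE s v : A s -> pr s v = multiplicity s v e :> nat.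
  move=> /sume sk; rewrite ffunE inordK // ltnS -[leqRHS]sk (bigD1 v) //=.
  exact: leq_addr.
rewrite -natr_sum !mulr_sumr.
rewrite (_ : (\sum_(s | A s) same_hyperedge s e e')%N =
   (\sum_(m : {ffun V -> 'I_k.+1} | (\sum_v m v)%N == k)
     #|[pred s | A s && [forall v, (multiplicity s v e == m v) &&
          (multiplicity s v e' == m v)]]|)%N).
  rewrite natr_sum mulr_suml; apply: eq_bigr => m /eqP mk.
  by rewrite -(equal_pair_probability ne ee mk).
rewrite (partition_big pr (fun m : {ffun V -> 'I_k.+1} => (\sum_v m v)%N == k))
  /= => [|s sA]; last first.
  by rewrite -[X in _ == X](sume s sA); apply/eqP/eq_bigr => v _; exact: prE.
apply: eq_bigr => m /eqP mk; rewrite -sum1_card.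
rewrite big_mkcond [RHS]big_mkcond; apply: eq_bigr => s _; rewrite inE.
case sA: (A s) => //=.
case: (pr s =P m) => [<-|nm].
  have -> : same_hyperedge s e e' = [forall v, (multiplicity s v e == pr s v)
      && (multiplicity s v e' == pr s v)].
    by apply: eq_forallb => v; rewrite prE // eqxx eq_sym.
  by case: [forall v, _].
case: ifP => // /forallP H; case: nm; apply/ffunP => v; apply: val_inj => /=.
by rewrite prE //; have /andP[/eqP] := H v.
Qed.

(** Linearity of expectation; pairs with different degrees drop out, as equal
    hyperedges have equal degrees. *)
Lemma expected_pairs_sum :
  expected_multi_hyperedge_pairs d delta R =
  2%:R^-1 * \sum_e \sum_(e' | (e' != e) && (delta e' == delta e))
     ((\sum_(s | A s) (same_hyperedge s e e')%:R) / #|A|%:R).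
Proof.
rewrite /expected_multi_hyperedge_pairs /unif_mean.
under [in RHS]eq_bigr do rewrite -mulr_suml.
rewrite -mulr_suml mulrA; congr (_ / _).
have pairsE s : (multi_hyperedge_pairs s)%:R =
    2%:R^-1 * \sum_e \sum_(e' | e' != e) (same_hyperedge s e e')%:R :> R.
  rewrite /multi_hyperedge_pairs.
  under eq_bigr do rewrite -natr_sum.
  rewrite -natr_sum sum_ordered_pairs ?natrM ?mulKf ?pnatr_eq0 //.
    by move=> e; apply/forallP => v.
  by move=> e f; apply: eq_forallb => v; rewrite eq_sym.
under eq_bigr do rewrite pairsE.
rewrite -mulr_sumr exchange_big /=; congr (_ * _); apply: eq_bigr => e _.
rewrite exchange_big /= [RHS]big_mkcondr; apply: eq_bigr => e' ne.
case: eqP => // nee; rewrite big1 // => s sA.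
by case H: (same_hyperedge s e e') => //; case: nee; exact: same_hyperedge_degree sA H.
Qed.
End Probability.

Theorem theorem2 (R : realFieldType) (V E : finType)
    (d : V -> nat) (delta : E -> nat)
    (hsum : (\sum_(v : V) d v = \sum_(e : E) delta e)%N)
    (hdelta : forall e : E,
       (delta e)%:R <= 2%:R^-1 * (#|V|%:R * degree_mean (R := R) d (fun k => k%:R)) :> R) :
  expected_multi_hyperedge_pairs d delta R =
  2%:R^-1 * \sum_(e : E) \sum_(e' : E | (e' != e) && (delta e' == delta e))
    ((total_degree d - 2 * delta e)`!%:R / (total_degree d)`!%:R *
     \sum_(a \in weight_vectors (delta e))
       ((delta e)`!%:R ^+ 2 / (\prod_(k < delta e) k.+1`! ^ (2 * a k))%N%:R *
        \sum_(alpha \in R_set a)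
          ((-1) ^+ (\big[addn/0%N]_(x \in [set: natvec (delta e)])
                      (((\sum_(i < delta e) x i) - 1) * alpha x))%N *
           \big[*%R/1]_(y \in [set: natvec (delta e)])
             ((alpha y)`!%:R^-1 * block_weight R d y ^+ alpha y)))).
Proof.
rewrite expected_pairs_sum; congr (_ * _); apply: eq_bigr => e _.
apply: eq_bigr => e' /andP[ne /eqP ee].
by rewrite same_hyperedge_probability // formula_vertex_sum.
Qed.
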